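(* There exist positive constants $c,c_1,c_2$ such that for all integers $t\ge 2$ and all positive integers $d$ with $d\ge c\log t$, the complete $t$-ary tree $T_d^t$ of depth $d$ satisfies $$c_1\sqrt{t}\,d\le b_e(T_d^t)\le (t-1)d\qquad\text{and}\qquad c_2\frac{d}{\sqrt{t}}\le b_v(T_d^t)\le d.$$
   Context: Graphs are finite, simple and undirected. For a graph $G=(V,E)$ and $S\subseteq V$, let $\delta(S,G)=\{(u,v)\in E: u\in S,\ v\in V-S\}$ be the edge boundary and $\phi(S,G)=\{v\in V-S:\exists u\in S,\ (u,v)\in E\}$ the vertex boundary. For $1\le i\le |V|$ let $b_e(i,G)=\min_{S\subseteq V,\ |S|=i}|\delta(S,G)|$ and $b_v(i,G)=\min_{S\subseteq V,\ |S|=i}|\phi(S,G)|$. The edge and vertex isoperimetric peaks are $b_e(G)=\max_{1\le i\le |V|}b_e(i,G)$ and $b_v(G)=\max_{1\le i\le |V|}b_v(i,G)$. The depth of a rooted tree is the number of nodes on the longest path starting from the root and ending at a leaf. The complete $t$-ary tree $T_d^t$ of depth $d$ is the rooted tree in which every non-leaf node has exactly $t$ children and every root-to-leaf path has exactly $d$ nodes; it has $(t^d-1)/(t-1)$ vertices. *)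

(* Defs.v *)
From HB Require Import structures.
From mathcomp Require Import all_boot.

Set Implicit Arguments.
Unset Strict Implicit.
Unset Printing Implicit Defensive.

Record sgraph := SGraph {
  vertex :> finType;
  adj : rel vertex;
  adj_sym : symmetric adj;
  adj_irrefl : irreflexive adj
}.

Section Isoperimetry.

Variable G : sgraph.
Implicit Types (S : {set G}) (i : nat).

(* A boundary edge is recorded as the pair whose first component lies in [S],
   so each undirected edge between [S] and its complement occurs once. *)
Definition edge_boundary S : {set G * G} :=
  [set e : G * G | [&& adj e.1 e.2, e.1 \in S & e.2 \notin S]].

Definition vertex_boundary S : {set G} :=
  [set v : G | (v \notin S) && [exists u in S, adj u v]].

(* The initial values of the [minn]s bound the size of every edge, respectively
   vertex, boundary, so they do not affect the minimum when some [S] has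
   cardinal [i], i.e. when [i <= #|G|]; see the lemmas below. *)
Definition edge_isop i : nat :=
  \big[minn/#|{: G * G}|]_(S : {set G} | #|S| == i) #|edge_boundary S|.

Definition vertex_isop i : nat :=
  \big[minn/#|G|]_(S : {set G} | #|S| == i) #|vertex_boundary S|.

Definition edge_peak : nat := \max_(1 <= i < #|G|.+1) edge_isop i.

Definition vertex_peak : nat := \max_(1 <= i < #|G|.+1) vertex_isop i.

Lemma bigmin_le (f : {set G} -> nat) m i S :
  #|S| = i -> \big[minn/m]_(A : {set G} | #|A| == i) f A <= f S.
Proof.
move=> Si; have := mem_index_enum S; elim: (index_enum _) => // A r IHr.
rewrite big_cons inE => /predU1P[<-|/IHr Sr]; first by rewrite Si eqxx geq_minl.
by case: ifP => // _; apply: leq_trans (geq_minr _ _) Sr.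
Qed.

Lemma bigmin_attained (f : {set G} -> nat) m i :
    (forall S, f S <= m) -> i <= #|G| ->
  exists2 S : {set G}, #|S| = i & \big[minn/m]_(S : {set G} | #|S| == i) f S = f S.
Proof.
move=> fm iG.
have [S0 /eqP S0i] : exists S : {set G}, #|S| == i.
  have : 0 < #|[set S : {set G} | #|S| == i]| by rewrite card_draws bin_gt0.
  by case/card_gt0P => S; rewrite inE; exists S.
have [S Si minS] : exists2 S : {set G}, #|S| = i & forall A : {set G}, #|A| = i -> f S <= f A.
  have P0 : #|S0| == i by apply/eqP.
  case: (@arg_minnP _ S0 [pred A : {set G} | #|A| == i] f P0) => S /eqP Si minS.
  by exists S => // A /eqP; apply: minS.
exists S => //; apply/eqP; rewrite eqn_leq; apply/andP; split.
  exact: bigmin_le.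
apply: (big_ind (fun k => f S <= k)) => //.
  by move=> a b Sa Sb; rewrite leq_min Sa.
by move=> A /eqP; apply: minS.
Qed.

Lemma edge_isop_attained i :
  i <= #|G| -> exists2 S : {set G}, #|S| = i & edge_isop i = #|edge_boundary S|.
Proof. by apply: bigmin_attained => S; apply: max_card. Qed.

Lemma edge_isop_le S : edge_isop #|S| <= #|edge_boundary S|.
Proof. exact: bigmin_le. Qed.

Lemma vertex_isop_attained i :
  i <= #|G| -> exists2 S : {set G}, #|S| = i & vertex_isop i = #|vertex_boundary S|.
Proof. by apply: bigmin_attained => S; apply: max_card. Qed.

Lemma vertex_isop_le S : vertex_isop #|S| <= #|vertex_boundary S|.
Proof. exact: bigmin_le. Qed.

End Isoperimetry.

Section CompleteTree.

Variables t d : nat.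

(* A node is the word of child indices read along the path from the root (the
   empty word).  A path from the root to a node labelled by a word of length
   [k] has [k + 1] nodes, so depth [d > 0] means words of length at most
   [d.-1], the leaves being those of length exactly [d.-1]. *)
Definition tree_node : finType := (d.-1).-bseq 'I_t.

Definition is_child (v u : tree_node) : bool :=
  [exists x : 'I_t, val v == rcons (val u) x].

Definition tree_adj : rel tree_node := fun u v => is_child v u || is_child u v.

Lemma tree_adj_sym : symmetric tree_adj.
Proof. by move=> u v; rewrite /tree_adj orbC. Qed.

Lemma tree_adj_irrefl : irreflexive tree_adj.
Proof.
move=> u; rewrite /tree_adj orbb; apply/existsP => -[x /eqP /(congr1 size)].
by rewrite size_rcons => /eqP; rewrite -[X in X == _]addn0 -addn1 eqn_add2l.
Qed.

Definition complete_tree : sgraph := SGraph tree_adj_sym tree_adj_irrefl.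

Lemma card_complete_tree :
  1 < t -> 0 < d -> #|complete_tree| = (t ^ d - 1) %/ (t - 1).
Proof.
move=> t1 d0; rewrite !subn1 predn_exp mulKn; last by case: t t1 => [|[]].
by rewrite card_bseq card_ord prednK.
Qed.

Lemma card_children (u : tree_node) :
  #|[set v | is_child v u]| = if size u < d.-1 then t else 0.
Proof.
case: ifPn => [ud|]; last first.
  rewrite -leqNgt => du; apply: eq_card0 => v; rewrite inE.
  apply/existsP => -[x /eqP vE]; have := size_bseq v.
  by rewrite vE size_rcons ltnNge du.
have rP x : size (rcons u x) <= d.-1 by rewrite size_rcons.
rewrite -[RHS]card_ord -cardsT -(@card_imset _ _ (fun x => Bseq (rP x))).
  apply: eq_card => v; rewrite !inE; apply/existsP/imsetP.
    by case=> x /eqP vE; exists x => //; apply: val_inj.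
  by case=> x _ ->; exists x.
by move=> x y /(congr1 val) /= /rcons_inj [].
Qed.

End CompleteTree.

(* Main.v *)
Require Import Defs.
From mathcomp Require Import all_boot all_order all_algebra.
From mathcomp Require Import reals exp.
From mathcomp Require Import zify ring lra.

Set Implicit Arguments.
Unset Strict Implicit.
Unset Printing Implicit Defensive.

(** The upper bounds come from a postorder traversal: the first [i] nodes of
    the traversal form a set closed under taking children, so its vertex
    boundary consists of the nodes in progress, one per level at most, and its
    edge boundary of their finished children.  A node in progress has an
    unfinished child, except for the single node that is next in the traversal;
    hence at most [(t - 1) (d - 1) + 1] boundary edges.

    The edge lower bound is a counting argument.  Let [N_j] be the number of
    nodes of [S] on level [j], and let [P_j], [Q_j] be the numbers of nodes on
    level [j] which enter, respectively leave, [S] when going down from their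
    parent.  Counting the nodes on level [j + 1] whose parent is in [S] in two
    ways gives [N_(j+1) + Q_(j+1) = t N_j + P_(j+1)] (lemma [level_rec]).  So
    [N_0] (0 or 1) together with the [P_j] and [Q_j] determines [|S|], while
    the sum of all [P_j] and [Q_j] is at most the size of the edge boundary.
    If every size in [1 .. |T|] is realised with at most [E] boundary edges,
    there are thus at least [|T|] vectors in [nat^(2(d-1))] with sum at most
    [E], up to the factor 2 for [N_0].  Weighting a vector of sum [s] by [x^s]
    with [0 < x < 1] yields
      [|T| x^E <= 2 (1 + x + ... + x^E)^(2(d-1)) <= 2 (1 - x)^(- 2(d-1))]
    (lemma [generating_bound]).  As [|T| >= t^(d-1)], taking
    [1 - x = 5 / (4 sqrt t)] makes the right-hand side exponentially smaller
    than [|T|]: [x^E <= 2 (16/25)^(d-1)], and since [ln (1/x)] is of order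
    [1 / sqrt t], [E] is at least of order [d sqrt t] once [d >= 6]
    (lemma [edge_peak_ge]).  The assumption [c ln t <= d] serves to ensure
    [d >= 6].

    The vertex lower bound follows, since degrees are at most [t + 1]. *)

(** * Boundaries and peaks in a graph *)

Lemma card_edge_boundaryE (G : sgraph) (S : {set G}) :
  #|edge_boundary S|
  = \sum_(v in vertex_boundary S) #|[set u in S | adj u v]|.
Proof.
rewrite -sum1_card.
rewrite (partition_big (fun e : G * G => e.2) (mem (vertex_boundary S))) /=.
  apply: eq_bigr => v; rewrite inE => /andP[vN _]; rewrite sum1dep_card.
  have pair_inj : injective (fun u : G => (u, v)) by move=> u1 u2 [].
  rewrite -(card_imset _ pair_inj); apply: eq_card => -[a b]; rewrite !inE /=.
  apply/andP/imsetP => [[/and3P[ab aS _] /eqP bv]|[u]].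
    by exists a; rewrite -?bv // inE aS.
  by rewrite inE => /andP[uS uv] [-> ->]; rewrite uv uS vN.
move=> e; rewrite !inE => /and3P[e12 e1 ->]; apply/existsP.
by exists e.1; rewrite e1.
Qed.

Lemma leq_peak (f : nat -> nat) i n :
  0 < i <= n -> f i <= \max_(1 <= j < n.+1) f j.
Proof. by move=> i_n; apply: leq_bigmax_seq; rewrite ?mem_index_iota. Qed.

(** * Ranks of words in postorder *)

Section PostOrder.
Variable t : nat.

(** The number of nodes of the complete tree whose root-to-leaf paths have [m]
    nodes. *)
Fixpoint ctree_size m := if m is m'.+1 then (t * ctree_size m').+1 else 0.

Lemma ctree_sizeE m : ctree_size m = \sum_(i < m) t ^ i.
Proof.
elim: m => [|m IHm]; first by rewrite big_ord0.
rewrite big_ord_recl /= IHm expn0 add1n big_distrr; congr _.+1.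
by apply: eq_bigr => i _; rewrite /= -expnS.
Qed.

(** The position of the node [w] in the postorder traversal of the tree of
    height [m] (with [m + 1] levels): a root comes after all of its
    [t * ctree_size m] proper descendants, and the subtree of child [x] comes
    after those of the [x] smaller children. *)
Fixpoint post_rank m (w : seq 'I_t) :=
  if w is x :: w' then x * ctree_size m + post_rank m.-1 w'
  else t * ctree_size m.

Lemma leq_ord_mul (x : 'I_t) n : x * n + n <= t * n.
Proof. by rewrite addnC -mulSn leq_mul2r ltn_ord orbT. Qed.

Lemma post_rank_lt m w : size w <= m -> post_rank m w < ctree_size m.+1.
Proof.
elim: w m => [|x w IHw] [|m] //= wm.
have /= := IHw m wm; have /= := leq_ord_mul x (ctree_size m.+1).
lia.
Qed.

(** The subtree of [w] has [ctree_size (m.+1 - size w)] nodes, and [w] comes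
    last among them. *)
Lemma post_rank_ge m w :
  size w <= m -> ctree_size (m.+1 - size w) <= (post_rank m w).+1.
Proof.
elim: w m => [|x w IHw] [|m] //= wm.
by have := IHw m wm; rewrite subSS => /leq_trans; apply; rewrite ltnS leq_addl.
Qed.

(** Between the child [x] of [w] and [w] itself, the traversal visits exactly
    the subtrees of the later siblings of [x]. *)
Lemma post_rank_rcons m w (x : 'I_t) : size w < m ->
  (post_rank m (rcons w x) + (t - x.+1) * ctree_size (m - size w)).+1
  = post_rank m w.
Proof.
elim: w m => [|y w IHw] [|m] //= wm; last first.
  by rewrite subSS -(IHw m wm) -addnA -addnS.
have /= := leq_ord_mul x (t * ctree_size m).+1; rewrite mulnBl mulSn; lia.
Qed.

Lemma post_rank_inj m w w' : size w <= m -> size w' <= m ->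
  post_rank m w = post_rank m w' -> w = w'.
Proof.
elim: w w' m => [|x w IHw] [|x' w'] [|m] //= wm wm'.
- have /= := leq_ord_mul x' (ctree_size m.+1).
  by have /= := post_rank_lt wm'; lia.
- have /= := leq_ord_mul x (ctree_size m.+1).
  by have /= := post_rank_lt wm; lia.
have /= := post_rank_lt wm; have /= := post_rank_lt wm'.
move=> lt' lt eq_r.
suff xx' : x = x' by move: eq_r; rewrite xx' => /addnI /IHw ->.
apply: val_inj => /=; case: (ltngtP x x') => // lt_x; exfalso.
  have := leq_mul lt_x (leqnn (t * ctree_size m).+1); rewrite mulSn; lia.
have := leq_mul lt_x (leqnn (t * ctree_size m).+1); rewrite mulSn; lia.
Qed.

(** Subtrees hanging from a common level are visited one after the other, and
    that of [w'] ends at [w']. *)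
Lemma post_rank_gap m w w' : size w <= m -> size w' = size w ->
  post_rank m w < post_rank m w' ->
  post_rank m w + ctree_size (m.+1 - size w) <= post_rank m w'.
Proof.
elim: w w' m => [|x w IHw] [|x' w'] [|m] //= wm; rewrite ?ltnn // => -[ww'].
have wm' : size w' <= m by rewrite ww'.
have /= lt := post_rank_lt wm; have /= lt' := post_rank_lt wm'.
have := post_rank_ge wm'; rewrite subSS ww' => ge'.
case: (ltngtP x x') => [lt_x|lt_x|<-].
- have := leq_mul lt_x (leqnn (t * ctree_size m).+1); rewrite mulSn; lia.
- have := leq_mul lt_x (leqnn (t * ctree_size m).+1); rewrite mulSn; lia.
by rewrite -addnA ltn_add2l leq_add2l; apply: IHw.
Qed.

End PostOrder.

(** * Nodes, parents and levels *)

Section Tree.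
Variables t d : nat.
Notation T := (complete_tree t d).
Notation node := (tree_node t d).

Lemma parent_subproof (v : node) : size (take (size v).-1 v) <= d.-1.
Proof. by rewrite size_take_min (leq_trans (geq_minr _ _)) ?size_bseq. Qed.

(** The root is its own parent. *)
Definition parent (v : node) : node := Bseq (parent_subproof v).

Lemma is_childE (v u : node) : is_child v u = (0 < size v) && (parent v == u).
Proof.
apply/existsP/andP => [[x /eqP vE]|[]].
  rewrite vE size_rcons; split=> //; apply/eqP/val_inj.
  by rewrite /= vE size_rcons /= -cats1 take_size_cat.
case: v => s sP /=; case/lastP: s sP => [//|w x] sP _ /eqP <-; exists x.
by rewrite /= size_rcons /= -[in X in take _ X]cats1 take_size_cat.
Qed.

Lemma is_child_size (v u : node) : is_child v u -> size v = (size u).+1.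
Proof. by case/existsP => x /eqP ->; rewrite size_rcons. Qed.

Lemma size_parent (v : node) : size (parent v) = (size v).-1.
Proof. by rewrite /= size_take_min; apply/minn_idPl/leq_pred. Qed.

Lemma card_complete_treeE : #|T| = ctree_size t d.-1.+1.
Proof. by rewrite card_bseq ctree_sizeE card_ord. Qed.

(** * Initial segments of the postorder traversal *)

Definition node_rank (v : node) := post_rank d.-1 v.

Lemma node_rank_inj : injective node_rank.
Proof. by move=> u v /post_rank_inj uv; apply/val_inj/uv; apply: size_bseq. Qed.

Definition post_segment i : {set T} := [set v : node | node_rank v < i].

Lemma card_post_segment i : i <= #|T| -> #|post_segment i| = i.
Proof.
move=> iT; have rlt (v : node) : node_rank v < #|T|.
  by rewrite card_complete_treeE post_rank_lt ?size_bseq.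
pose f (v : T) := Ordinal (rlt v).
have f_inj : injective f by move=> u v [] /node_rank_inj.
have [g fK gK] : bijective f by apply: inj_card_bij; rewrite ?card_ord.
rewrite -(card_imset _ f_inj).
have -> : #|f @: post_segment i| = #|[set k : 'I_#|T| | k < i]|.
  apply: eq_card => k; rewrite inE; apply/imsetP/idP.
    by case=> v; rewrite inE => vi ->.
  move=> ki; exists (g k); rewrite ?gK // inE.
  by rewrite -[node_rank _]/(val (f (g k))) gK.
have widen_inj : injective (widen_ord iT).
  by move=> j k /(congr1 val) /= jk; apply: val_inj.
rewrite -[RHS]card_ord -(card_imset _ widen_inj).
apply: eq_card => k; rewrite inE; apply/idP/imsetP => [ki|[j _ ->]] //=.
by exists (Ordinal ki) => //; apply: val_inj.
Qed.

Lemma node_rank_child (v w : node) : is_child v w ->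
  exists2 k, k < t &
    (node_rank v + k * ctree_size t (d.-1 - size w)).+1 = node_rank w.
Proof.
move=> vw; have sw : size w < d.-1 by rewrite -(is_child_size vw) size_bseq.
case/existsP: vw => x /eqP vE; exists (t - x.+1).
  by have := ltn_ord x; lia.
by rewrite /node_rank vE post_rank_rcons.
Qed.

Lemma post_segment_edge i (u v : node) :
  tree_adj u v -> u \in post_segment i -> v \notin post_segment i ->
  is_child u v.
Proof.
rewrite !inE -leqNgt /tree_adj => /orP[vu|//] ui vi.
by have [k _] := node_rank_child vu; lia.
Qed.

Lemma post_boundary_child i (v : node) :
    v \in vertex_boundary (post_segment i : {set T}) ->
  exists2 u : node, is_child u v & node_rank u < i <= node_rank v.
Proof.
rewrite inE => /andP[vN /existsP[u /andP[uS uv]]].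
exists u; first exact: post_segment_edge uv uS vN.
by move: uS vN; rewrite !inE -leqNgt => -> ->.
Qed.

(** If [u] and [v] are both in progress and [v] comes later, then the whole
    subtree of [v] comes after [u], so no child of [v] is visited yet. *)
Lemma post_boundary_level i (u v : node) :
    u \in vertex_boundary (post_segment i : {set T}) ->
    v \in vertex_boundary (post_segment i : {set T}) ->
  size u = size v -> u = v.
Proof.
wlog ruv : u v / node_rank u <= node_rank v.
  move=> W; have [/W//|/ltnW/W W' hu hv /esym uv] :=
    leqP (node_rank u) (node_rank v).
  exact/esym/W'.
case/post_boundary_child => _ _ /andP[_ iu].
case/post_boundary_child => a av /andP[ai _] uv; apply/eqP/idPn => neq_uv.
have lt_uv : node_rank u < node_rank v.
  by rewrite ltn_neqAle ruv andbT; apply: contra neq_uv => /eqP/node_rank_inj->.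
have sv : size v < d.-1 by rewrite -(is_child_size av) size_bseq.
have [k kt rk] := node_rank_child av.
have := post_rank_gap (size_bseq u) (esym uv) lt_uv.
rewrite uv subSn ?size_bseq //= -/(node_rank u) -/(node_rank v).
have := leq_mul kt (leqnn (ctree_size t (d.-1 - size v))); rewrite mulSn.
by move: rk iu ai; set c := ctree_size t _; move: (c) => {}c; lia.
Qed.

Lemma card_post_vertex_boundary i :
  #|vertex_boundary (post_segment i : {set T})| <= d.-1.
Proof.
set B := vertex_boundary _; rewrite -(size_iota 0 d.-1) cardE.
rewrite -(size_map (fun v : node => size v)); apply: uniq_leq_size.
  rewrite map_inj_in_uniq ?enum_uniq // => u v; rewrite !mem_enum.
  exact: post_boundary_level.
move=> _ /mapP[v vB ->]; rewrite mem_enum in vB.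
have [a av _] := post_boundary_child vB.
by rewrite mem_iota /= add0n -(is_child_size av) size_bseq.
Qed.

(** The last child of [w] immediately precedes [w] in postorder, so it belongs
    to the segment only if [w] has rank exactly [i]: all other boundary nodes
    have at most [t - 1] children in the segment. *)
Lemma card_post_edge_boundary i :
  #|edge_boundary (post_segment i : {set T})| <= t.-1 * d.-1 + 1.
Proof.
set S := post_segment i; rewrite card_edge_boundaryE.
set B := vertex_boundary (S : {set T}).
apply: (@leq_trans (\sum_(w in B) (t.-1 + (node_rank w == i)))).
  apply: leq_sum => w /post_boundary_child[a aw /andP[_ iw]].
  have sw : size (w : node) < d.-1 by rewrite -(is_child_size aw) size_bseq.
  have t0 : 0 < t.
    by have [k kt _] := node_rank_child aw; apply: leq_ltn_trans kt.
  have cw := card_children w; rewrite sw in cw.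
  set F := [set _ in _ | _].
  have FC v : v \in F -> is_child (v : node) w /\ v \in S.
    rewrite inE => /andP[vS vw]; split=> //.
    by apply: (post_segment_edge vw vS); rewrite inE -leqNgt.
  have [wi|wi] := eqVneq (node_rank w) i.
    rewrite addn1 prednK //; apply: leq_trans (eq_leq cw).
    by apply/subset_leq_card/subsetP => v /FC[? _]; rewrite inE.
  have tP : t.-1 < t by rewrite prednK.
  have rP : size (rcons (w : node) (Ordinal tP)) <= d.-1 by rewrite size_rcons.
  pose last_child : node := Bseq rP.
  have rank_last : (node_rank last_child).+1 = node_rank w.
    rewrite /node_rank -(post_rank_rcons (Ordinal tP) sw) /=.
    by rewrite prednK // subnn mul0n addn0.
  rewrite addn0 -ltnS prednK //; apply: leq_trans (eq_leq cw).
  apply/proper_card/properP; split.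
    by apply/subsetP => v /FC[? _]; rewrite inE.
  exists last_child; first by rewrite inE; apply/existsP; exists (Ordinal tP).
  by apply/negP => /FC[_]; rewrite !inE; lia.
rewrite big_split /= sum_nat_const; apply: leq_add.
  by rewrite mulnC leq_mul2l card_post_vertex_boundary orbT.
rewrite -big_mkcondr sum1dep_card; apply/card_le1_eqP => u v.
by rewrite !inE => /andP[_ /eqP <-] /andP[_ /eqP /node_rank_inj].
Qed.

Lemma edge_peak_le : 1 < t -> 0 < d -> edge_peak T <= t.-1 * d.
Proof.
move=> t1 d0.
apply/bigmax_leqP_seq => i; rewrite mem_index_iota ltnS => /andP[i0 iT] _.
rewrite -(card_post_segment iT); apply: leq_trans (edge_isop_le _) _.
apply: leq_trans (card_post_edge_boundary _) _.
by case: d d0 => // d' _; rewrite mulnS addnC leq_add2r; lia.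
Qed.

Lemma vertex_peak_le : vertex_peak T <= d.
Proof.
apply/bigmax_leqP_seq => i; rewrite mem_index_iota ltnS => /andP[i0 iT] _.
rewrite -(card_post_segment iT); apply: leq_trans (vertex_isop_le _) _.
exact: leq_trans (card_post_vertex_boundary _) (leq_pred _).
Qed.

(** * A set is determined in size by its membership changes along levels *)

Definition level (S : {set T}) j : {set node} :=
  [set v : node | (v \in S) && (size v == j)].

(** The nodes on level [j + 1] that enter ([b = true]) or leave ([b = false])
    [S] when going down from their parent. *)
Definition flips (S : {set T}) j b : {set node} :=
  [set v : node | [&& size v == j.+1, (v \in S) == b & (parent v \in S) != b]].

(** The set [X] of nodes on level [j + 1] whose parent is in [S] has [t]
    elements for each element of [S] on level [j]; it differs from the set of elements
    of [S] on level [j + 1] by the nodes leaving and entering [S]. *)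
Lemma level_rec (S : {set T}) j : j < d.-1 ->
  #|level S j.+1| + #|flips S j false| = t * #|level S j| + #|flips S j true|.
Proof.
move=> jd.
pose X : {set node} :=
  [set v : node | (size v == j.+1) && (parent v \in S)].
have <- : #|X| = t * #|level S j|.
  rewrite -sum1_card (partition_big parent (mem (level S j))) => [|v]; last first.
    by rewrite !inE size_parent => /andP[/eqP-> ->] /=.
  rewrite mulnC -sum_nat_const; apply: eq_bigr => u.
  rewrite !inE => /andP[uS /eqP uj].
  have := card_children u; rewrite uj jd; apply: etrans; rewrite sum1dep_card.
  apply: eq_card => v; rewrite !inE is_childE.
  case: (eqVneq (parent v) u) => [vu|]; last by rewrite !andbF.
  have := size_parent v; rewrite vu uj uS !andbT => ->.
  by case: (size v) => //= n; rewrite eqxx.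
have <- : #|level S j.+1 :\: X| = #|flips S j true|.
  apply: eq_card => v; rewrite !inE.
  by case: (_ == j.+1); case: (v \in S); case: (parent v \in S).
have <- : #|X :\: level S j.+1| = #|flips S j false|.
  apply: eq_card => v; rewrite !inE.
  by case: (_ == j.+1); case: (v \in S); case: (parent v \in S).
rewrite -(cardsID X (level S j.+1)) -(cardsID (level S j.+1) X) setIC; lia.
Qed.

(** Each flip happens on an edge from a node to its parent, which lies in the
    boundary of [S]; the edge and its orientation tell the node, hence its
    level, and the kind of flip. *)
Lemma sum_flips_le (S : {set T}) :
  \sum_(p : 'I_d.-1 * bool) #|flips S p.1 p.2| <= #|edge_boundary S|.
Proof.
pose Q := [pred q : ('I_d.-1 * bool) * node | q.2 \in flips S q.1.1 q.1.2].
pose e (q : ('I_d.-1 * bool) * node) : T * T :=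
  if q.1.2 then (q.2, parent q.2) else (parent q.2, q.2).
have e_inj : {in Q &, injective e}.
  move=> [[j b] v] [[j' b'] v']; rewrite !inE /e /=.
  move=> /and3P[/eqP sj /eqP <- pv] /and3P[/eqP sj' /eqP <- pv'].
  have sv := size_parent v; have sv' := size_parent v'.
  case: ifP => vS; case: ifP => vS' [].
  - move=> vv' _; rewrite vv'; congr (_, _, _); apply: val_inj.
    by move: sj sj'; rewrite vv' => ->; case.
  (* Otherwise [v] and [v'] would be parents of each other. *)
  - by move=> vv' v'v; move: sv sv'; rewrite -vv' v'v sj sj' /=; lia.
  - by move=> vv' v'v; move: sv sv'; rewrite vv' -v'v sj sj' /=; lia.
  - move=> _ vv'; rewrite vv'; congr (_, _, _); apply: val_inj.
    by move: sj sj'; rewrite vv' => ->; case.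
under eq_bigr do rewrite -sum1_card.
rewrite pair_big_dep /= sum1_card -(card_in_imset e_inj).
apply/subset_leq_card/subsetP => _ /imsetP[[[j b] v] vQ ->]; move: vQ.
rewrite !inE /e /= => /and3P[/eqP sj vb pv].
have vp : is_child v (parent v) by rewrite is_childE sj eqxx.
by case: b vb pv => /eqP -> /=; rewrite ?eqb_id ?eqbF_neg ?negbK => pv;
  rewrite /tree_adj vp ?orbT ?pv.
Qed.

Lemma card_levels (S : {set T}) : #|S| = \sum_(j < d.-1.+1) #|level S j|.
Proof.
pose lev (v : node) : 'I_d.-1.+1 := inord (size v).
rewrite -sum1_card (partition_big lev predT) //=.
apply: eq_bigr => j _; rewrite sum1dep_card; apply: eq_card => v; rewrite !inE.
by rewrite -val_eqE /= inordK // ltnS size_bseq.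
Qed.

Lemma card_level0 (S : {set T}) : #|level S 0| = (0 < #|level S 0|).
Proof.
have : #|level S 0| <= 1.
  apply/card_le1_eqP => u v.
  rewrite !inE => /andP[_ /nilP u0] /andP[_ /nilP v0].
  by apply: val_inj; rewrite /= u0 v0.
by case: #|_| => [|[]].
Qed.

Lemma flips_determine_card (S S' : {set T}) :
    (0 < #|level S 0|) = (0 < #|level S' 0|) ->
    (forall j b, j < d.-1 -> #|flips S j b| = #|flips S' j b|) ->
  #|S| = #|S'|.
Proof.
move=> eq0 eqf; rewrite !card_levels; apply: eq_bigr => -[j /= jd] _.
elim: j jd => [|j IHj] jd; first by rewrite card_level0 eq0 -card_level0.
have := level_rec S jd.
by rewrite (IHj (ltnW jd)) !eqf // -level_rec // => /addIn.
Qed.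

(** * Lower bounds *)

(** A boundary node has at most [t] children and one parent. *)
Lemma edge_le_vertex_boundary (S : {set T}) :
  #|edge_boundary S| <= t.+1 * #|vertex_boundary S|.
Proof.
rewrite card_edge_boundaryE mulnC -sum_nat_const; apply: leq_sum => v _.
apply: (@leq_trans #|parent v |: [set u : node | is_child u v]|).
  apply/subset_leq_card/subsetP => u; rewrite !inE => /andP[_].
  rewrite /adj /= /tree_adj => /orP[|->]; last by rewrite orbT.
  by rewrite is_childE eq_sym => /andP[_ ->].
rewrite cardsU1 card_children -[t.+1]add1n; apply: leq_add; first exact: leq_b1.
by case: ifP.
Qed.

Lemma edge_peak_le_vertex : edge_peak T <= t.+1 * vertex_peak T.
Proof.
apply/bigmax_leqP_seq => i; rewrite mem_index_iota ltnS => /andP[i0 iT] _.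
have [S Si vS] := vertex_isop_attained iT.
apply: leq_trans (_ : t.+1 * vertex_isop T i <= _).
  by rewrite vS -Si (leq_trans (edge_isop_le S)) ?edge_le_vertex_boundary.
by rewrite leq_mul2l leq_peak ?i0 ?orbT.
Qed.

Local Open Scope ring_scope.
Import Order.TTheory GRing.Theory Num.Theory.

(** Choosing a set [F k] of each size [k + 1], the map [data] sends [k] to the
    root bit and the flip counts of [F k], and is injective.  The generating
    function in [x] of all possible such data factors over the [2 (d - 1)]
    counts, and [data k] contributes at least [x ^+ E] to it. *)
Lemma generating_bound (R : numDomainType) (x : R) E :
    0 < x -> x <= 1 ->
    (forall i, (0 < i <= #|T|)%N ->
      exists2 S : {set T}, #|S| = i & (#|edge_boundary S| <= E)%N) ->
  #|T|%:R * x ^+ E <= 2 * (\sum_(m < E.+1) x ^+ m) ^+ (2 * d.-1).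
Proof.
move=> x0 x1 exS.
have exS1 (k : 'I_#|T|) : exists2 S : {set T},
    #|S| = k.+1 & (#|edge_boundary S| <= E)%N by apply: exS; rewrite ltn_ord.
have [F FS FE] := fin_all_exists2 exS1.
have flE k (p : 'I_d.-1 * bool) : (#|flips (F k) p.1 p.2| <= E)%N.
  apply: leq_trans (FE k); apply: leq_trans (sum_flips_le _).
  by rewrite (bigD1 p) ?leq_addr.
pose data k : bool * {ffun 'I_d.-1 * bool -> 'I_E.+1} :=
  ((0 < #|level (F k) 0|)%N,
   [ffun p : 'I_d.-1 * bool => inord #|flips (F k) p.1 p.2|]).
have data_inj : injective data.
  move=> k l [eq0 /ffunP eqf]; apply/val_inj/succn_inj; rewrite -!FS.
  apply: flips_determine_card => // j b jd.
  have := congr1 val (eqf (Ordinal jd, b)).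
  by rewrite !ffunE /= !inordK // ltnS (flE _ (Ordinal jd, b)).
pose w (c : bool * {ffun 'I_d.-1 * bool -> 'I_E.+1}) : R := \prod_p x ^+ c.2 p.
have w0 c : 0 <= w c by apply: prodr_ge0 => p _; rewrite exprn_ge0 ?ltW.
apply: (@le_trans _ _ (\sum_(k < #|T|) w (data k))).
  rewrite -[X in X%:R]card_ord mulr_natl -sumr_const; apply: ler_sum => k _.
  rewrite /w prodrXr; apply: ler_wiXn2l; rewrite ?(ltW x0) //.
  apply: leq_trans (FE k); apply: leq_trans (sum_flips_le _).
  by apply: leq_sum => p _; rewrite ffunE inordK ?ltnS.
have -> : \sum_k w (data k) = \sum_(c in [set data k | k in predT]) w c.
  by rewrite big_imset //= => k l _ _ /data_inj.
apply: (@le_trans _ _ (\sum_c w c)).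
  by rewrite [leRHS](bigID (mem [set data k | k in predT])) /= lerDl sumr_ge0.
rewrite -(pair_bigA _ (fun b f => w (b, f))) /= big_bool /w /= -mulr2n.
rewrite -(bigA_distr_bigA (fun _ (m : 'I_E.+1) => x ^+ m)) prodr_const.
by rewrite card_prod card_ord card_bool mulnC mulr_natl.
Qed.

Lemma geometric_le (R : numFieldType) (x : R) n :
  0 <= x -> x < 1 -> \sum_(m < n) x ^+ m <= (1 - x)^-1.
Proof.
move=> x0 x1; have x1' : 0 < 1 - x by rewrite subr_gt0.
rewrite -[leRHS]mul1r ler_pdivlMr // mulrC -opprB mulNr -subrX1 opprB.
by rewrite gerBl exprn_ge0.
Qed.

(** Taking logarithms, with [ln (1 + y) <= y] applied to [1 / x - 1],
    [16 / 25 - 1] and [2 - 1], where [x = 1 - 1 / a] has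
    [1 / x = 1 + 1 / (a - 1)]. *)
Lemma exponent_ge (R : realType) (a : R) (E h : nat) : 1 < a ->
  (1 - a^-1) ^+ E <= 2 * (16 / 25) ^+ h ->
  (9 / 25 * h%:R - 1) * (a - 1) <= E%:R.
Proof.
move=> a1; set x := 1 - a^-1 => key.
have x0 : 0 < x by rewrite subr_gt0 invf_lt1 //; lra.
have am : 0 < a - 1 by lra.
have lnx : ln x *+ E <= ln 2 + ln (16 / 25) *+ h.
  by rewrite -!lnXn // -?lnM ?ler_ln ?posrE ?mulr_gt0 ?exprn_gt0 //; lra.
have ln2 : ln 2 <= 1 :> R by have := @le_ln1Dx R 1; apply; lra.
have ln1625 : ln (16 / 25) <= - (9 / 25) :> R.
  have -> : 16 / 25 = 1 + - (9 / 25) :> R by field.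
  by apply: le_ln1Dx; lra.
have lnxi : - ln x <= (a - 1)^-1.
  have xi : x^-1 = 1 + (a - 1)^-1.
    by rewrite /x; field; apply/andP; split; apply/eqP; lra.
  rewrite -lnV ?posrE // xi; apply: le_ln1Dx.
  by apply: lt_trans (_ : 0 < _); rewrite ?invr_gt0; lra.
rewrite -ler_pdivlMr //.
move: lnx; rewrite -(mulr_natl (ln x)) -(mulr_natl (ln (16 / 25))) => lnx.
have hln := ler_wpM2l (ler0n R h) ln1625.
have Eln := ler_wpM2l (ler0n R E) lnxi.
lra.
Qed.

Lemma edge_peak_ge (R : realType) : (1 < t)%N -> (5 < d)%N ->
  200^-1 * Num.sqrt (t%:R : R) * d%:R <= (edge_peak T)%:R.
Proof.
move=> t1 d5; set u := Num.sqrt _; set E := edge_peak T.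
have u2 : u ^+ 2 = t%:R by rewrite sqr_sqrtr ?ler0n.
have t2 : 2 <= t%:R :> R by rewrite ler_nat.
have u0 : 0 <= u by apply: sqrtr_ge0.
have u43 : 4 / 3 <= u.
  by rewrite -ler_sqr ?nnegrE ?divr_ge0 // u2; lra.
(* Up to the final constant, any factor strictly between [1 / sqrt 2] and 1
   works here: being below 1, it makes [a ^+ (2 * d.-1)] exponentially smaller
   than [t ^ d.-1]; being above [1 / sqrt 2], it keeps [a - 1] at least a fixed
   fraction of [u] for all [t >= 2]. *)
pose a : R := 4 / 5 * u.
have a1 : 1 < a by rewrite /a; lra.
have a0 : 0 < a by lra.
pose x : R := 1 - a^-1.
have x0 : 0 < x by rewrite subr_gt0 invf_lt1.
have x1 : x < 1 by rewrite gtrBl invr_gt0.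
have : #|T|%:R * x ^+ E <= 2 * (\sum_(m < E.+1) x ^+ m) ^+ (2 * d.-1).
  apply: generating_bound => // [|i /andP[i0 iT]]; first exact: ltW.
  have [S Si eS] := edge_isop_attained iT; exists S; rewrite // -eS.
  by rewrite leq_peak ?i0.
have : (\sum_(m < E.+1) x ^+ m) ^+ (2 * d.-1) <= (16 / 25 * t%:R) ^+ d.-1.
  have -> : 16 / 25 * t%:R = a ^+ 2 by rewrite /a -u2; field.
  rewrite -exprM lerXn2r ?nnegrE ?(ltW a0) //.
    by apply: sumr_ge0 => m _; rewrite exprn_ge0 ?ltW.
  apply: le_trans (geometric_le _ (ltW x0) x1) _.
  by rewrite /x opprB addrC subrK invrK.
have : t%:R ^+ d.-1 <= #|T|%:R :> R.
  by rewrite -natrX ler_nat card_bseq big_ord_recr /= card_ord leq_addl.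
set h := d.-1; rewrite exprMn => Th sh bound.
have th0 : 0 < t%:R ^+ h :> R by rewrite exprn_gt0 // (lt_le_trans _ t2).
have key : x ^+ E <= 2 * (16 / 25) ^+ h.
  rewrite -(ler_pM2l th0); apply: le_trans (_ : #|T|%:R * x ^+ E <= _).
    by rewrite ler_pM2r ?exprn_gt0.
  by apply: le_trans bound _; rewrite [leRHS]mulrCA ler_pM2l // mulrC.
have {Th sh bound th0 key} fin := exponent_ge a1 key.
have hd : h%:R = d%:R - 1 :> R by rewrite /h -subn1 natrB //; lia.
have d6 : 6 <= d%:R :> R by rewrite ler_nat.
apply: le_trans fin; rewrite mulrC.
have -> : d%:R * (200^-1 * u) = (d%:R / 10) * (u / 20) by field.
by apply: ler_pM; rewrite ?hd /a ?divr_ge0 //; lra.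
Qed.

End Tree.

Local Open Scope ring_scope.
Import Order.TTheory GRing.Theory Num.Theory.

Theorem corollary2 (R : realType) :
  exists c c1 c2 : R, [/\ 0 < c, 0 < c1, 0 < c2 &
    forall t d : nat, (2 <= t)%N -> (0 < d)%N -> c * ln (t%:R : R) <= d%:R ->
      (c1 * Num.sqrt (t%:R : R) * d%:R
         <= ((edge_peak (complete_tree t d))%:R : R)
         <= (t%:R - 1) * d%:R) /\
      (c2 * (d%:R / Num.sqrt (t%:R : R))
         <= ((vertex_peak (complete_tree t d))%:R : R)
         <= d%:R)].
Proof.
have ln2 : 0 < ln 2 :> R by rewrite ln_gt0 ?ltr1n.
exists (6 / ln 2), 200^-1, 400^-1; split; rewrite ?divr_gt0 ?invr_gt0 //.
move=> t d t2 d0 dt.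
(* [ln t >= ln 2] turns the hypothesis on [d] into [6 <= d]. *)
have d6 : (5 < d)%N.
  rewrite -(ler_nat R); apply: le_trans dt.
  rewrite -mulrA mulrC -{1}[6]mul1r ler_pM2r // mulrC ler_pdivlMr // mul1r.
  by rewrite ler_ln ?posrE ?ler_nat ?ltr0n // (leq_trans _ t2).
have lower := @edge_peak_ge t d R t2 d6.
split; apply/andP; split; rewrite ?ler_nat ?vertex_peak_le //.
  have := edge_peak_le t2 d0; rewrite -(ler_nat R) natrM.
  by case: (t) t2 => // n _; rewrite -natr1 addrK.
set u := Num.sqrt _ in lower *.
have t2' : 2 <= t%:R :> R by rewrite ler_nat.
have u2 : u ^+ 2 = t%:R by rewrite sqr_sqrtr ?ler0n.
have u0 : 0 < u by rewrite sqrtr_gt0; lra.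
have := edge_peak_le_vertex t d; rewrite -(ler_nat R) natrM -natr1 => ev.
set V : R := (vertex_peak _)%:R in ev *.
have V0 : 0 <= V by apply: ler0n.
have cancel_u : 200^-1 * d%:R <= 2 * V * u.
  rewrite -(ler_pM2l u0); apply: le_trans (_ : (t%:R + 1) * V <= _).
    by apply: le_trans ev; rewrite mulrCA mulrA.
  have -> : u * (2 * V * u) = 2 * u ^+ 2 * V by ring.
  by rewrite u2 ler_wpM2r //; lra.
by rewrite mulrA ler_pdivrMr //; lra.
Qed.
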